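(* Let $(G,H,\alpha,\beta)$ be a matched pair of left braces. Then $G\times H$ is a left brace with sum $$(a,b)+(a',b'):=(a+a',b+b')$$ and lambda maps given by $$\lambda_{(a,b)}(a',b')=\left(\alpha_b\lambda^{(1)}_{\alpha_b^{-1}(a)}(a'),\;\beta_a\lambda^{(2)}_{\beta_a^{-1}(b)}(b')\right),$$ that is, with product $(a,b)\cdot(a',b'):=(a,b)+\lambda_{(a,b)}(a',b')$. Moreover, $G\times\{0\}$ and $\{0\}\times H$ are two left ideals of $G\times H$, isomorphic to $G$ and $H$ respectively as left braces, and such that $(G\times H,+)=(G\times\{0\})\oplus(\{0\}\times H)$. Conversely, if $B$ is a left brace, and $I_1$ and $I_2$ are two left ideals of $B$ such that $(B,+)=(I_1,+)\oplus(I_2,+)$, then there is a matched pair of left braces $(I_1,I_2,\alpha,\beta)$ such that $B$ is isomorphic, as a left brace, to the left brace $I_1\times I_2$ defined by the sum and lambda maps above.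
   Context: A left brace is a set $B$ with two binary operations $+$ and $\cdot$ such that $(B,+)$ is an abelian group, $(B,\cdot)$ is a group, and $a\cdot(b+c)+a=a\cdot b+a\cdot c$ for all $a,b,c\in B$. For $a\in B$ the lambda map is $\lambda_a:B\to B$, $\lambda_a(b)=a\cdot b-a$; it is an automorphism of $(B,+)$, and $a\mapsto\lambda_a$ is a group homomorphism $(B,\cdot)\to\operatorname{Aut}(B,+)$. A left ideal of $B$ is a subgroup $L$ of $(B,\cdot)$ such that $\lambda_b(x)\in L$ for all $b\in B$, $x\in L$; a left ideal is also a subgroup of $(B,+)$ and is a left brace under the restricted operations. Let $G$ and $H$ be left braces with lambda maps $\lambda^{(1)}$ and $\lambda^{(2)}$ respectively. Let $\alpha:(H,\cdot)\to\operatorname{Aut}(G,+)$, $b\mapsto\alpha_b$, and $\beta:(G,\cdot)\to\operatorname{Aut}(H,+)$, $a\mapsto\beta_a$, be group homomorphisms. $(G,H,\alpha,\beta)$ is called a matched pair of left braces if for all $a\in G$ and $b\in H$ $$\lambda^{(1)}_a\circ\alpha_b=\alpha_{\beta_a(b)}\circ\lambda^{(1)}_{\alpha^{-1}_{\beta_a(b)}(a)}\quad\text{and}\quad\lambda^{(2)}_b\circ\beta_a=\beta_{\alpha_b(a)}\circ\lambda^{(2)}_{\beta^{-1}_{\alpha_b(a)}(b)},$$ where $\alpha^{-1}_x$ and $\beta^{-1}_x$ denote the inverse automorphisms $(\alpha_x)^{-1}$ and $(\beta_x)^{-1}$. *)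

(* Defs.v *)
From HB Require Import structures.
From mathcomp Require Import all_boot.
From mathcomp Require Import boolp classical_sets.

Set Implicit Arguments.
Unset Strict Implicit.
Unset Printing Implicit Defensive.

Import Algebra.
(* In this order, [+], [-], [0] denote the additive group and [*], [1], [^-1]
   the multiplicative group of a left brace. *)
Local Open Scope classical_set_scope.
Local Open Scope ring_scope.
Local Open Scope group_scope.

HB.mixin Record isLeftBrace B of Zmodule B & Group B := {
  braceD : forall a b c : B, a * (b + c) + a = a * b + a * c
}.

#[short(type="leftBraceType")]
HB.structure Definition LeftBrace :=
  { B of Zmodule B & Group B & isLeftBrace B }.

Definition lambda (B : leftBraceType) (a b : B) : B := a * b - a.

Section BraceTheory.
Variable B : leftBraceType.
Implicit Types a b c : B.

Lemma brace1 : 1 = 0 :> B.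
Proof.
have := braceD (1 : B) 0 0; rewrite !mul1g addr0 add0r; exact.
Qed.

Lemma lambdaE a b : a * b = a + lambda a b.
Proof. by rewrite /lambda addrC subrK. Qed.

Lemma lambdaD a : {morph lambda a : b c / b + c}.
Proof.
move=> b c; rewrite /lambda.
have -> : a * (b + c) = a * b + a * c - a by rewrite -braceD addrK.
by rewrite -addrA -addrA -addrA; congr (_ + _); rewrite addrCA.
Qed.

Lemma lambdaM a b : lambda (a * b) =1 lambda a \o lambda b.
Proof.
move=> c /=; apply: (@addrI _ (a * b)); rewrite -lambdaE -mulgA.
by rewrite (lambdaE b c) (lambdaE a (b + _)) lambdaD addrA -lambdaE.
Qed.

Lemma lambda1 : lambda (1 : B) =1 id.
Proof. by move=> a; rewrite /lambda mul1g brace1 subr0. Qed.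

Lemma addE a b : a + b = a * lambda a^-1 b.
Proof. by rewrite lambdaE -[lambda a _]/((_ \o _) b) -lambdaM mulgV lambda1. Qed.

Lemma oppE a : - a = lambda a a^-1.
Proof. by rewrite /lambda mulgV brace1 add0r. Qed.

End BraceTheory.

(* The group Aut(V, +), under composition. *)
Record addAut (V : zmodType) := AddAut {
  aut_fun :> V -> V;
  aut_inv : V -> V;
  autD : {morph aut_fun : x y / x + y};
  autK : cancel aut_fun aut_inv;
  autVK : cancel aut_inv aut_fun
}.

Section AddAutGroup.
Variable V : zmodType.
Implicit Types f g h : addAut V.

Lemma addAut_eq f g : f =1 g -> f = g.
Proof.
case: f g => [f f' fD fK f'K] [g g' gD gK g'K] /= /funext efg; subst g.
have efg' : f' = g' by apply: funext => x; rewrite -{1}[x]g'K fK.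
subst g'; congr AddAut; exact: Prop_irrelevance.
Qed.

HB.instance Definition _ := gen_eqMixin (addAut V).
HB.instance Definition _ := gen_choiceMixin (addAut V).

Definition aut_id : addAut V :=
  @AddAut V id id (fun _ _ => erefl) (fun _ => erefl) (fun _ => erefl).

Fact aut_compD f g : {morph f \o g : x y / x + y}.
Proof. by move=> x y /=; rewrite !autD. Qed.

Definition aut_comp f g : addAut V :=
  AddAut (aut_compD f g) (can_comp (@autK _ f) (@autK _ g))
    (can_comp (@autVK _ g) (@autVK _ f)).

Fact aut_invD f : {morph aut_inv f : x y / x + y}.
Proof. by move=> x y; apply: (can_inj (@autK _ f)); rewrite autD !autVK. Qed.

Definition aut_opp f : addAut V :=
  AddAut (aut_invD f) (@autVK _ f) (@autK _ f).

Fact aut_compA : associative aut_comp.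
Proof. by move=> f g h; apply: addAut_eq. Qed.
Fact aut_comp1f : left_id aut_id aut_comp.
Proof. by move=> f; apply: addAut_eq. Qed.
Fact aut_compf1 : right_id aut_id aut_comp.
Proof. by move=> f; apply: addAut_eq. Qed.
Fact aut_compVf : left_inverse aut_id aut_opp aut_comp.
Proof. by move=> f; apply: addAut_eq => x /=; rewrite autK. Qed.
Fact aut_compfV : right_inverse aut_id aut_opp aut_comp.
Proof. by move=> f; apply: addAut_eq => x /=; rewrite autVK. Qed.

HB.instance Definition _ := isGroup.Build (addAut V)
  aut_compA aut_comp1f aut_compf1 aut_compVf aut_compfV.

End AddAutGroup.

Record leftIdeal (B : leftBraceType) := LeftIdeal {
  ideal_set :> set B;
  ideal_group : group_closed [in ideal_set];
  ideal_lambda : forall b x : B, ideal_set x -> ideal_set (lambda b x)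
}.

Definition ideal_sort (B : leftBraceType) (I : leftIdeal B) : Type :=
  set_type I.

Section IdealBrace.
Variables (B : leftBraceType) (I : leftIdeal B).

Fact ideal_zmod : zmod_closed [in ideal_set I].
Proof.
have IV := group_closedV (ideal_group I).
have IM := group_closedM (ideal_group I).
have IL b x : x \in ideal_set I -> lambda b x \in ideal_set I.
  by rewrite !inE; apply: ideal_lambda.
split; first by rewrite -brace1; case: (ideal_group I).
by move=> x y xI yI; rewrite addE IM// IL// oppE IL// IV.
Qed.

HB.instance Definition _ := SubChoice.on (ideal_sort I).
HB.instance Definition _ :=
  SubChoice_isSubZmodule.Build B [in ideal_set I] (ideal_sort I)
    ideal_zmod.
HB.instance Definition _ :=
  SubChoice_isSubGroup.Build B [in ideal_set I] (ideal_sort I)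
    (ideal_group I).

Fact ideal_braceD (a b c : ideal_sort I) : a * (b + c) + a = a * b + a * c.
Proof. by apply: val_inj; exact: (braceD (val a) (val b) (val c)). Qed.

HB.instance Definition _ := isLeftBrace.Build (ideal_sort I) ideal_braceD.

End IdealBrace.

Definition ideal_brace (B : leftBraceType) (I : leftIdeal B) : leftBraceType :=
  ideal_sort I.
Coercion ideal_brace : leftIdeal >-> leftBraceType.

Definition additive_direct_sum (B : leftBraceType) (I J : set B) : Prop :=
  (forall b : B, exists x y, [/\ I x, J y & b = x + y]) /\
  I `&` J = [set 0].

Definition brace_isomorphic (B C : leftBraceType) : Prop :=
  exists f : B -> C,
    [/\ bijective f, {morph f : x y / x + y} & {morph f : x y / x * y}].

Section MatchedPair.
Variables (G H : leftBraceType).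
Variables (alpha : {multiplicative H -> addAut G}).
Variables (beta : {multiplicative G -> addAut H}).

Definition matched_pair : Prop := forall (a : G) (b : H),
  (lambda a \o alpha b =1
     alpha (beta a b) \o lambda ((alpha (beta a b))^-1 a)) /\
  (lambda b \o beta a =1
     beta (alpha b a) \o lambda ((beta (alpha b a))^-1 b)).

Definition matched_lambda (x y : G * H) : G * H :=
  (alpha x.2 (lambda ((alpha x.2)^-1 x.1) y.1),
   beta x.1 (lambda ((beta x.1)^-1 x.2) y.2)).

(* The operations are taken in the brace structure [c] rather than in the
   canonical componentwise structures on pairs, hence the explicit [@]. *)
Definition is_matched_product (c : LeftBrace (G * H)%type) : Prop :=
  let P := LeftBrace.Pack c in
  forall x y : G * H,
    [/\ @add P x y = (x.1 + y.1, x.2 + y.2),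
        @lambda P x y = matched_lambda x y
      & @mul P x y = @add P x (matched_lambda x y)].

End MatchedPair.

(* Main.v *)
(* Over an abelian group [V], a left brace structure is the same as a map
   [L : V -> Aut(V, +)] with [L (x + L x y) = L x * L y].  The matched pair
   condition says that the two components of [matched_lambda] can be written in
   two ways, e.g. [alpha b * lambda (alpha b ^-1 a) = lambda a * alpha (beta a ^-1 b)];
   choosing the right form at each step gives the identity for [L].
   Conversely [lambda] restricts to the two ideals, and both the matched pair
   condition and the isomorphism [(a, b) |-> a + b] come from writing [a + b]
   either as [a * lambda a ^-1 b] or as [b * lambda b ^-1 a]. *)

Require Import Defs.
From HB Require Import structures.
From mathcomp Require Import all_boot.
From mathcomp Require Import boolp classical_sets.

Set Implicit Arguments.
Unset Strict Implicit.
Unset Printing Implicit Defensive.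

Import Algebra.
Local Open Scope classical_set_scope.
Local Open Scope ring_scope.
Local Open Scope group_scope.

(** * Additive automorphisms *)

Lemma aut0 (V : zmodType) (f : addAut V) : f 0 = 0.
Proof. by apply: (@addrI _ (f 0)); rewrite -autD !addr0. Qed.

Lemma autMV (V : zmodType) (f : addAut V) : cancel f^-1 f.
Proof. exact: autVK. Qed.

Lemma autVM (V : zmodType) (f : addAut V) : cancel f f^-1.
Proof. exact: autK. Qed.

Lemma autM (V : zmodType) (f g : addAut V) x : (f * g) x = f (g x).
Proof. by []. Qed.

Lemma group_morph1 (X Y : groupType) (f : {multiplicative X -> Y}) : f 1 = 1.
Proof. by apply: (@mulgI _ (f 1)); rewrite -gmulfM !mulg1. Qed.

(** * Left braces built from a lambda map *)

Record lambda_map (V : zmodType) := LambdaMap {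
  lmap :> V -> addAut V;
  lmapM : forall x y, lmap (x + lmap x y) = lmap x * lmap y
}.

(** An alias of [V] that records [L], so that the new brace structure does not clash with the
    structures already on [V]. *)
Definition brace_of (V : zmodType) (L : lambda_map V) : Type := V.

Section BraceOfLambda.
Variables (V : zmodType) (L : lambda_map V).
Implicit Types x y z : V.

Let mul x y : V := x + L x y.
Let inv x : V := (L x)^-1 (- x).

Fact lmap0 : L 0 = 1.
Proof.
apply: (@mulgI _ (L 0)); rewrite mulg1 -lmapM.
by rewrite aut0 addr0.
Qed.

Fact brace_of_mulA : associative mul.
Proof. by move=> x y z; rewrite /mul autD addrA lmapM. Qed.

Fact brace_of_mul1 : left_id 0 mul.
Proof. by move=> x; rewrite /mul lmap0 add0r. Qed.

Fact brace_of_mulr1 : right_id 0 mul.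
Proof. by move=> x; rewrite /mul aut0 addr0. Qed.

Fact brace_of_mulV : right_inverse 0 inv mul.
Proof. by move=> x; rewrite /mul /inv autMV subrr. Qed.

Fact brace_of_mulVr : left_inverse 0 inv mul.
Proof.
(* [lmapM] at [inv x] applies because [x + L x (inv x) = 0] and [L 0 = 1]. *)
move=> x; have LV : L (inv x) = (L x)^-1.
  by apply: (@mulgI _ (L x)); rewrite mulgV -lmapM -/(mul _ _) brace_of_mulV lmap0.
by rewrite /mul LV /inv -autD addNr aut0.
Qed.

HB.instance Definition _ := Zmodule.copy (brace_of L) V.
HB.instance Definition _ := isGroup.Build (brace_of L)
  brace_of_mulA brace_of_mul1 brace_of_mulr1 brace_of_mulVr brace_of_mulV.

Fact brace_of_braceD (a b c : brace_of L) : a * (b + c) + a = a * b + a * c.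
Proof.
rewrite -[a * (b + c)]/(a + L a (b + c)) autD.
by rewrite -[a * b]/(a + L a b) -[a * c]/(a + L a c) -!addrA [L a c + a]addrC.
Qed.

HB.instance Definition _ := isLeftBrace.Build (brace_of L) brace_of_braceD.

Lemma brace_of_lambda (x y : brace_of L) : lambda x y = L x y.
Proof. by rewrite /lambda -[x * y]/(x + L x y) addrAC subrr add0r. Qed.

End BraceOfLambda.

(** * The lambda action on a brace and on its left ideals *)

Section LambdaTheory.
Variable B : leftBraceType.
Implicit Types (a b x : B) (I : leftIdeal B).

Lemma lambdaK a : cancel (lambda a) (lambda a^-1).
Proof.
by move=> x; rewrite -[LHS]/((_ \o _) x) -lambdaM mulVg lambda1.
Qed.

Lemma lambdaVK a : cancel (lambda a^-1) (lambda a).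
Proof.
by move=> x; rewrite -[LHS]/((_ \o _) x) -lambdaM mulgV lambda1.
Qed.

Definition lambda_aut a : addAut B :=
  AddAut (@lambdaD B a) (lambdaK a) (lambdaVK a).

Fact lambda_autM : {morph lambda_aut : a b / a * b}.
Proof. by move=> a b; apply: addAut_eq => x /=; rewrite lambdaM. Qed.

HB.instance Definition _ := isMultiplicative.Build B (addAut B) lambda_aut lambda_autM.

Lemma lambda0 a : lambda a 0 = 0.
Proof. exact: (aut0 (lambda_aut a)). Qed.

Lemma lambda_add a b : lambda (a + b) =1 lambda a \o lambda (lambda a^-1 b).
Proof. by move=> x; rewrite addE lambdaM. Qed.

(** Both sides are lambda of [a * b = a + lambda a b], a sum that [lambda_add] can expand from
    either summand. *)
Lemma lambda_swap a b :
  lambda a \o lambda b =1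
  lambda (lambda a b) \o lambda (lambda (lambda a b)^-1 a).
Proof. by move=> x; rewrite -lambda_add addrC -lambdaE lambdaM. Qed.

(** Products and inverses are additive up to lambda: [x * y = x + lambda x y] and
    [y^-1 = - lambda y^-1 y]. *)
Lemma lambda_group_closed (S : set B) :
    S 0 -> (forall x y, S x -> S y -> S (x - y)) ->
    (forall b x, S x -> S (lambda b x)) ->
  group_closed [in S].
Proof.
move=> S0 SB SL; split; first by rewrite brace1 inE.
move=> x y; rewrite !inE => Sx Sy; rewrite lambdaE.
have SN z : S z -> S (- z) by move=> Sz; rewrite -[- z]add0r; apply: SB.
rewrite -[lambda _ _]opprK; apply: (SB) => //; apply: (SN); apply: (SL).
have -> : y^-1 = - lambda y^-1 y by rewrite -{3}[y]invgK -oppE opprK.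
by apply: (SN); apply: (SL).
Qed.

Section Restriction.
Variable I : leftIdeal B.

(** All of [B] acts, not only [I]: restricting [a] to a complementary ideal will give [alpha] and
    [beta]. *)
Definition ideal_act a (x : I) : I :=
  SigSub (mem_set (ideal_lambda a (set_valP x))) : ideal_sort I.

Fact ideal_actD a : {morph ideal_act a : x y / x + y}.
Proof. by move=> x y; apply: val_inj; exact: lambdaD. Qed.

Fact ideal_actK a : cancel (ideal_act a) (ideal_act a^-1).
Proof. by move=> x; apply: val_inj; exact: lambdaK. Qed.

Fact ideal_actVK a : cancel (ideal_act a^-1) (ideal_act a).
Proof. by move=> x; apply: val_inj; exact: lambdaVK. Qed.

Definition ideal_aut a : addAut I :=
  AddAut (@ideal_actD a) (@ideal_actK a) (@ideal_actVK a).

Fact ideal_autM : {morph ideal_aut : a b / a * b}.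
Proof. by move=> a b; apply: addAut_eq => x; apply: val_inj; exact: lambdaM. Qed.

HB.instance Definition _ := isMultiplicative.Build B (addAut I) ideal_aut ideal_autM.

End Restriction.
End LambdaTheory.

(** * Automorphisms of a product and the components of [matched_lambda] *)

Section PairAut.
Variables (V W : zmodType) (f : addAut V) (g : addAut W).

Let fg (x : V * W) := (f x.1, g x.2).
Let fgV (x : V * W) := (aut_inv f x.1, aut_inv g x.2).

Fact pair_autD : {morph fg : x y / x + y}.
Proof. by move=> x y; rewrite /fg /= !autD. Qed.

Fact pair_autK : cancel fg fgV.
Proof. by case=> x y; rewrite /fg /fgV /= !autK. Qed.

Fact pair_autVK : cancel fgV fg.
Proof. by case=> x y; rewrite /fg /fgV /= !autVK. Qed.

Definition pair_aut : addAut (V * W)%type := AddAut pair_autD pair_autK pair_autVK.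

End PairAut.

(* One of the two mirror-image halves of [matched_pair], so that each component
   of [matched_lambda] is treated by the same lemmas. *)
Definition half_matched (G H : leftBraceType)
    (alpha : {multiplicative H -> addAut G})
    (beta : {multiplicative G -> addAut H}) :=
  forall (a : G) (b : H),
    lambda_aut a * alpha b =
    alpha (beta a b) * lambda_aut ((alpha (beta a b))^-1 a).

Section HalfMatched.
Variables (G H : leftBraceType).
Variables (alpha : {multiplicative H -> addAut G}).
Variables (beta : {multiplicative G -> addAut H}).

Definition half_aut (a : G) (b : H) : addAut G :=
  alpha b * lambda_aut ((alpha b)^-1 a).

Lemma half_aut_add (a a' : G) (b : H) :
  a + half_aut a b a' = alpha b ((alpha b)^-1 a * a').
Proof. by rewrite lambdaE autD autMV. Qed.

(** Since [0 = 1] in [H], [alpha 0] is the identity; hence the factor [G * {0}] multiplies as [G]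
    does. *)
Lemma half_aut0 (a : G) : half_aut a 0 = lambda_aut a.
Proof. by rewrite /half_aut -brace1 group_morph1 invg1 mul1g. Qed.

Hypothesis mp : half_matched alpha beta.

Lemma half_autE a b : half_aut a b = lambda_aut a * alpha ((beta a)^-1 b).
Proof. by rewrite mp autMV. Qed.

(** The index [b2] is the second component of the product, in the multiplicative form that lets
    [alpha b2] split. After cancelling [alpha b], the claim is [mp] at [u * a'] and
    [(beta a')^-1 b']. *)
Lemma half_autM (a a' : G) (b b' : H) :
    let b2 := b * beta ((alpha b)^-1 a) b' in
  half_aut (a + half_aut a b a') b2 = half_aut a b * half_aut a' b'.
Proof.
set u := (alpha b)^-1 a => /=.
rewrite half_aut_add -/u (half_autE a' b') /half_aut -/u.
have -> : beta u b' = beta (u * a') ((beta a')^-1 b').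
  by rewrite gmulfM /= autMV.
rewrite gmulfM invgM -mulgA -[in RHS]mulgA [lambda_aut u * _]mulgA.
rewrite -gmulfM mp; congr (_ * (_ * lambda_aut _)).
by rewrite autM autVM.
Qed.

End HalfMatched.

(** * The matched product and its two factors *)

Section MatchedProduct.
Variables (G H : leftBraceType).
Variables (alpha : {multiplicative H -> addAut G}).
Variables (beta : {multiplicative G -> addAut H}).
Hypothesis mp : matched_pair alpha beta.

Let mp1 : half_matched alpha beta.
Proof. by move=> a b; apply: addAut_eq; exact: (mp a b).1. Qed.

Let mp2 : half_matched beta alpha.
Proof. by move=> b a; apply: addAut_eq; exact: (mp a b).2. Qed.

Definition matched_aut (x : G * H) : addAut (G * H)%type :=
  pair_aut (half_aut alpha x.1 x.2) (half_aut beta x.2 x.1).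

(** Quantified over the braces so that it serves both [mp1] and [mp2]; it turns the sum in one
    component into the product [b2] of [half_autM] for the other. *)
Let half_autD (G' H' : leftBraceType)
    (alpha' : {multiplicative H' -> addAut G'})
    (beta' : {multiplicative G' -> addAut H'}) :
    half_matched alpha' beta' -> forall a b a',
  a + half_aut alpha' a b a' = a * alpha' ((beta' a)^-1 b) a'.
Proof. by move=> m a b a'; rewrite (half_autE m) lambdaE. Qed.

Fact matched_autM x y :
  matched_aut (x + matched_aut x y) = matched_aut x * matched_aut y.
Proof.
apply: addAut_eq => z; congr pair.
  rewrite -[RHS]/((half_aut alpha x.1 x.2 * half_aut alpha y.1 y.2) z.1).
  by rewrite -(half_autM mp1) -(half_autD mp2).
rewrite -[RHS]/((half_aut beta x.2 x.1 * half_aut beta y.2 y.1) z.2).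
by rewrite -(half_autM mp2) -(half_autD mp1).
Qed.

Definition matched_map := LambdaMap matched_autM.

(** Typechecks because [brace_of matched_map] unfolds to [G * H]. *)
Definition matched_class : LeftBrace (G * H)%type :=
  LeftBrace.class (brace_of matched_map : leftBraceType).

Lemma matched_classP : is_matched_product alpha beta matched_class.
Proof.
move=> x y; split=> //; exact: (@brace_of_lambda _ matched_map x y).
Qed.

Let P : leftBraceType := LeftBrace.Pack matched_class.

Fact left_factor_lambda (x y : P) :
  ([set: G] `*` [set 0]) y -> ([set: G] `*` [set 0]) (lambda x y).
Proof.
case=> _ y0; have [_ xy _] := matched_classP x y.
by rewrite [lambda x y]xy; split=> //=; rewrite y0 lambda0 aut0.
Qed.

Fact right_factor_lambda (x y : P) :
  ([set 0] `*` [set: H]) y -> ([set 0] `*` [set: H]) (lambda x y).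
Proof.
case=> y0 _; have [_ xy _] := matched_classP x y.
by rewrite [lambda x y]xy; split=> //=; rewrite y0 lambda0 aut0.
Qed.

Fact left_factor_closed : group_closed [in ([set: G] `*` [set 0] : set P)].
Proof.
apply: lambda_group_closed left_factor_lambda => // x y [_ /= x0] [_ /= y0].
by split=> //=; rewrite x0 y0 subrr.
Qed.

Fact right_factor_closed : group_closed [in ([set 0] `*` [set: H] : set P)].
Proof.
apply: lambda_group_closed right_factor_lambda => // x y [/= x0 _] [/= y0 _].
by split=> //=; rewrite x0 y0 subrr.
Qed.

Definition left_factor := LeftIdeal left_factor_closed left_factor_lambda.
Definition right_factor := LeftIdeal right_factor_closed right_factor_lambda.

Lemma left_factor_iso : brace_isomorphic left_factor G.
Proof.
exists (fun x => (val x).1); split=> //.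
  have Ia (a : G) : ((a, 0) : P) \in ideal_set left_factor by rewrite inE.
  exists (fun a => SigSub (Ia a)) => // x; apply: val_inj => /=.
  have pE (p : P) : ([set: G] `*` [set 0]) p -> (p.1, 0) = p.
    by case: p => a b [_ /= ->].
  exact: pE (set_valP x).
move=> x y /=; have [_ /= x0] := set_valP x.
rewrite -[LHS]/((val x).1 + half_aut alpha (val x).1 (val x).2 (val y).1).
by rewrite x0 half_aut0 [RHS]lambdaE.
Qed.

Lemma right_factor_iso : brace_isomorphic right_factor H.
Proof.
exists (fun x => (val x).2); split=> //.
  have Jb (b : H) : ((0, b) : P) \in ideal_set right_factor by rewrite inE.
  exists (fun b => SigSub (Jb b)) => // x; apply: val_inj => /=.
  have pE (p : P) : ([set 0] `*` [set: H]) p -> (0, p.2) = p.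
    by case: p => a b [/= -> _].
  exact: pE (set_valP x).
move=> x y /=; have [/= x0 _] := set_valP x.
rewrite -[LHS]/((val x).2 + half_aut beta (val x).2 (val x).1 (val y).2).
by rewrite x0 half_aut0 [RHS]lambdaE.
Qed.

Lemma factors_direct_sum : additive_direct_sum left_factor right_factor.
Proof.
split=> [[a b]|].
  exists (a, 0), (0, b); split=> //.
  by rewrite -[RHS]/(a + 0, 0 + b) addr0 add0r.
apply/seteqP; split=> [[a b] [[_ /= ->] [/= -> _]]|_ ->] //.
Qed.

End MatchedProduct.

(** * Decomposing a brace into two left ideals *)

Section DirectSum.
Variables (B : leftBraceType) (I1 I2 : leftIdeal B).
Hypothesis dI : additive_direct_sum I1 I2.

Definition ideal_alpha : {multiplicative I2 -> addAut I1} :=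
  @ideal_aut B I1 \o (val : ideal_sort I2 -> B).
Definition ideal_beta : {multiplicative I1 -> addAut I2} :=
  @ideal_aut B I2 \o (val : ideal_sort I1 -> B).

Lemma ideal_matched_pair : matched_pair ideal_alpha ideal_beta.
Proof.
by move=> a b; split=> x; apply: val_inj; exact: (lambda_swap (val _) (val _)).
Qed.

Let P : leftBraceType := LeftBrace.Pack (matched_class ideal_matched_pair).

Definition ideal_sum (x : P) : B := val x.1 + val x.2.

Lemma ideal_sum_inj : injective ideal_sum.
Proof.
move=> [x1 x2] [y1 y2]; rewrite /ideal_sum /= => e.
have e' : val (x1 - y1) = val (y2 - x2).
  rewrite -[LHS]/(val x1 - val y1) -[RHS]/(val y2 - val x2).
  apply/eqP; rewrite subr_eq addrAC eq_sym subr_eq addrC.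
  by rewrite e.
(* The common difference lies in both ideals, so it is zero. *)
have z : (ideal_set I1 `&` I2) (val (x1 - y1)).
  by split; [exact: set_valP | rewrite e'; exact: set_valP].
rewrite dI.2 in z.
congr pair; apply/eqP.
  by rewrite -subr_eq0; apply/eqP/val_inj.
by rewrite eq_sym -subr_eq0; apply/eqP/val_inj; rewrite -e'.
Qed.

Lemma ideal_sumD : {morph ideal_sum : x y / x + y}.
Proof. by move=> x y; rewrite /ideal_sum addrACA. Qed.

Lemma ideal_sumM : {morph ideal_sum : x y / x * y}.
Proof.
move=> x y; rewrite [x * y]lambdaE ideal_sumD [RHS]lambdaE; congr (_ + _).
rewrite [lambda (ideal_sum x) _]lambdaD.
(* Only the copy acting on [y.1] is commuted: it then expands from [x.2], as the [alpha] component
   requires, and the copy acting on [y.2] from [x.1]. *)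
rewrite {1}[ideal_sum x]addrC !lambda_add.
by rewrite (@brace_of_lambda _ (matched_map ideal_matched_pair) x y).
Qed.

Lemma direct_sum_iso : brace_isomorphic B P.
Proof.
(* The isomorphism is a chosen section of [ideal_sum]; injectivity of [ideal_sum] makes it a
   two-sided inverse and a morphism. *)
have /choice[f fK] : forall b : B, exists x : P, ideal_sum x = b.
  move=> b; have [x [y [Ix Jy ->]]] := dI.1 b.
  by exists (SigSub (mem_set Ix), SigSub (mem_set Jy)).
exists f; split=> [|x y|x y].
- by exists ideal_sum => // x; apply: ideal_sum_inj; rewrite fK.
- by apply: ideal_sum_inj; rewrite ideal_sumD !fK.
- by apply: ideal_sum_inj; rewrite ideal_sumM !fK.
Qed.

End DirectSum.

Theorem theorem4p2 :
  (forall (G H : leftBraceType)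
      (alpha : {multiplicative H -> addAut G})
      (beta : {multiplicative G -> addAut H}),
    matched_pair alpha beta ->
    exists c : LeftBrace (G * H)%type,
      is_matched_product alpha beta c /\
      exists I J : leftIdeal (LeftBrace.Pack c),
        [/\ ideal_set I = [set: G] `*` [set 0],
            ideal_set J = [set 0] `*` [set: H],
            brace_isomorphic I G,
            brace_isomorphic J H
          & additive_direct_sum I J]) /\
  (forall (B : leftBraceType) (I1 I2 : leftIdeal B),
    additive_direct_sum I1 I2 ->
    exists (alpha : {multiplicative I2 -> addAut I1})
           (beta : {multiplicative I1 -> addAut I2}),
      matched_pair alpha beta /\
      exists c : LeftBrace (I1 * I2)%type,
        is_matched_product alpha beta c /\
        brace_isomorphic B (LeftBrace.Pack c)).
Proof.
split=> [G H alpha beta mp|B I1 I2 dI].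
  exists (matched_class mp); split; first exact: matched_classP.
  exists (left_factor mp), (right_factor mp); split=> //.
  - exact: left_factor_iso.
  - exact: right_factor_iso.
  - exact: factors_direct_sum.
exists (@ideal_alpha B I1 I2), (@ideal_beta B I1 I2).
split; first exact: ideal_matched_pair.
exists (matched_class (@ideal_matched_pair B I1 I2)).
by split; [exact: matched_classP | exact: direct_sum_iso].
Qed.
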